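(* Let $k\ge 1$ and let $G$ be a graph without isolated vertices such that $M_k(G)$ is a connected matroid. Let $K\subseteq E(G)$. Then the following are equivalent: (c1) $K$ is a non-separating cocircuit of $M_k(G)$; (c2) there exists $x\in V(G)$ such that $K=S(x,G)$, $s(x,G)\le\rho^*_k(G)$, and moreover $G\setminus x\in\mathcal{CG}_{\bowtie}$ if $k=1$, and $G\setminus x\in\mathcal{G}_{\bowtie}$ if $k\ge2$.
   Context: Graphs are finite and may have loops and parallel edges. For $X\subseteq E(G)$, $G\langle X\rangle$ is the subgraph of $G$ with edge set $X$ whose vertices are the end-vertices of edges in $X$. $\Delta G=|E(G)|-|V(G)|$. $\mathcal{G}_{\bowtie}$ is the set of graphs having no isolated vertices, no leaves (vertices of degree 1, a loop contributing 2 to the degree), and no cycle components (components that are cycles; a vertex with a single loop is a cycle, and two parallel edges form a cycle). $\mathcal{CG}_{\bowtie}$ is the set of connected graphs in $\mathcal{G}_{\bowtie}$. For $k\ge1$ the $k$-circular matroid $M_k(G)$ is the matroid on $E(G)$ whose circuits are the sets $C\subseteq E(G)$ with $\Delta G\langle C\rangle=k$ and $G\langle C\rangle\in\mathcal{G}_{\bowtie}$ (these are known to be the circuits of a matroid). $\rho^*_k(G)$ is the corank of $M_k(G)$, i.e. $|E(G)|$ minus the rank of $M_k(G)$. A matroid is connected if its ground set is nonempty, it has no loops and no coloops, and every two elements belong to a common circuit. A cocircuit $K$ of a connected matroid $M$ is non-separating if the deletion $M\setminus K$ is a connected matroid. $S(x,G)$ is the set of edges of $G$ incident to $x$ (loops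 included) and $s(x,G)=|S(x,G)|$. $G\setminus x$ is $G$ with vertex $x$ and all edges incident to it deleted. *)

(* Defs.v *)
From mathcomp Require Import all_boot all_order all_algebra.
From mathcomp Require Import zify.

Set Implicit Arguments.
Unset Strict Implicit.
Unset Printing Implicit Defensive.

(* The vertex set and the edge set are subsets of ambient finite types, so that
   subgraphs of [G] live in the same type as [G].  Edges are undirected: the
   set [ends e] has one element when [e] is a loop and two otherwise; the value
   of [ends] outside [edges] is irrelevant. *)
Record graph (V E : finType) := Graph {
  vertices : {set V};
  edges : {set E};
  ends : E -> {set V};
  endsP : forall e, e \in edges ->
    (ends e \subset vertices) && (0 < #|ends e| <= 2)
}.

Section GraphDefs.
Context {V E : finType}.
Implicit Types (G H : graph V E) (u v x : V) (X : {set E}).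

Definition is_loop G (e : E) : bool := #|ends G e| == 1.

Definition star x G : {set E} := [set e in edges G | x \in ends G e].

Definition degree G v : nat :=
  \sum_(e in star v G) (if is_loop G e then 2 else 1).

Definition Delta G : int := (#|edges G|%:Z - #|vertices G|%:Z)%R.

Definition adj G : rel V :=
  [rel u v | [exists e in edges G, (u \in ends G e) && (v \in ends G e)]].

Definition graph_connected G : bool :=
  (vertices G != set0) &&
  [forall u in vertices G, forall v in vertices G, connect (adj G) u v].

(* A loop at a vertex, and two parallel edges, are cycles with one and two
   vertices. *)
Definition is_cycle G : bool :=
  graph_connected G && [forall v in vertices G, degree G v == 2].

Fact edge_subgraph_subproof G X e : e \in X :&: edges G ->
  (ends G e \subset \bigcup_(f in X :&: edges G) ends G f)
  && (0 < #|ends G e| <= 2).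
Proof.
move=> eX; rewrite bigcup_sup //=.
by case/setIP: eX => _ /endsP/andP[].
Qed.

Definition edge_subgraph G X : graph V E :=
  Graph (@edge_subgraph_subproof G X).

Fact delete_vertex_subproof G x e : e \in edges G :\: star x G ->
  (ends G e \subset vertices G :\ x) && (0 < #|ends G e| <= 2).
Proof.
rewrite !inE negb_and => /andP[xe eG]; rewrite eG /= in xe.
have /andP[sub ->] := endsP eG; rewrite andbT.
by rewrite subsetD1 sub.
Qed.

Definition delete_vertex G x : graph V E :=
  Graph (@delete_vertex_subproof G x).

Definition component_vertices G v : {set V} :=
  [set u in vertices G | connect (adj G) v u].

Fact component_subproof G v e :
  e \in [set f in edges G | ends G f \subset component_vertices G v] ->
  (ends G e \subset component_vertices G v) && (0 < #|ends G e| <= 2).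
Proof. by rewrite inE => /andP[/endsP/andP[_ ->] ->]. Qed.

Definition component G v : graph V E := Graph (@component_subproof G v).

Definition no_isolated G : bool := [forall v in vertices G, degree G v != 0].

Definition no_leaf G : bool := [forall v in vertices G, degree G v != 1].

Definition no_cycle_component G : bool :=
  [forall v in vertices G, ~~ is_cycle (component G v)].

Definition bowtie G : bool :=
  [&& no_isolated G, no_leaf G & no_cycle_component G].

Definition connected_bowtie G : bool := graph_connected G && bowtie G.

End GraphDefs.

Record matroid (E : finType) := Matroid {
  ground : {set E};
  circuits : {set {set E}};
  circuit_sub : forall C, C \in circuits -> C \subset ground;
  circuit_neq0 : set0 \notin circuits;
  circuit_min : forall C1 C2,
    C1 \in circuits -> C2 \in circuits -> C1 \subset C2 -> C1 = C2;
  circuit_elim : forall C1 C2 e,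
    C1 \in circuits -> C2 \in circuits -> C1 != C2 -> e \in C1 :&: C2 ->
    exists2 C3, C3 \in circuits & C3 \subset (C1 :|: C2) :\ e
}.

Section MatroidDefs.
Context {E : finType}.
Implicit Types (M : matroid E) (I B K : {set E}).

Definition indep M I : bool :=
  (I \subset ground M) && [forall C in circuits M, ~~ (C \subset I)].

Definition mrank M : nat := \max_(I : {set E} | indep M I) #|I|.

Definition corank M : nat := #|ground M| - mrank M.

Definition basis M B : bool := maxset (indep M) B.

Definition coindep M I : bool :=
  [exists B : {set E}, basis M B && (I \subset ground M :\: B)].

Definition cocircuit M K : bool :=
  minset (fun I => (I \subset ground M) && ~~ coindep M I) K.

Definition mloop M (e : E) : bool := [set e] \in circuits M.

Definition coloop M (e : E) : bool :=
  (e \in ground M) && [forall B : {set E}, basis M B ==> (e \in B)].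

Definition matroid_connected M : Prop :=
  [/\ ground M != set0,
      forall e, e \in ground M -> ~~ mloop M e,
      forall e, e \in ground M -> ~~ coloop M e
    & forall e f, e \in ground M -> f \in ground M -> e != f ->
        exists2 C, C \in circuits M & (e \in C) && (f \in C)].

Section Deletion.
Variables (M : matroid E) (K : {set E}).

Let dground := ground M :\: K.
Let dcircuits := [set C in circuits M | C \subset dground].

Fact deletion_sub C : C \in dcircuits -> C \subset dground.
Proof. by rewrite inE => /andP[]. Qed.

Fact deletion_neq0 : set0 \notin dcircuits.
Proof. by rewrite inE negb_and circuit_neq0. Qed.

Fact deletion_min C1 C2 :
  C1 \in dcircuits -> C2 \in dcircuits -> C1 \subset C2 -> C1 = C2.
Proof.
by rewrite !inE => /andP[C1M _] /andP[C2M _]; apply: circuit_min C1M C2M.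
Qed.

Fact deletion_elim C1 C2 e :
  C1 \in dcircuits -> C2 \in dcircuits -> C1 != C2 -> e \in C1 :&: C2 ->
  exists2 C3, C3 \in dcircuits & C3 \subset (C1 :|: C2) :\ e.
Proof.
rewrite !(inE, in_setI) => /andP[C1M C1K] /andP[C2M C2K] neq eC.
have [|C3 C3M C3s] := circuit_elim C1M C2M neq (e := e); first by rewrite inE.
exists C3 => //; rewrite inE C3M /=; apply: (subset_trans C3s).
by apply: (subset_trans (subD1set _ _)); rewrite subUset C1K.
Qed.

Definition deletion : matroid E :=
  Matroid deletion_sub deletion_neq0 deletion_min deletion_elim.

End Deletion.

Definition nonseparating_cocircuit M K : Prop :=
  cocircuit M K /\ matroid_connected (deletion M K).

End MatroidDefs.

Section KCircular.
Context {V E : finType}.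
Implicit Types (G H : graph V E) (u v x : V) (X Y C : {set E}).

Definition kcircuits (k : nat) G : {set {set E}} :=
  [set C : {set E} | [&& C \subset edges G,
     (Delta (edge_subgraph G C) == k%:Z)%R & bowtie (edge_subgraph G C)]].

Let w G e := if is_loop G e then 2 else 1.

Let w_ends G e : e \in edges G -> w G e * #|ends G e| = 2.
Proof.
move=> /endsP/andP[_]; rewrite /w /is_loop.
by case: eqP => [->|] //; case: #|_| => [|[|[|]]].
Qed.

Let sum_degree G (W : {set V}) :
  \sum_(v in W) degree G v = \sum_(e in edges G) w G e * #|W :&: ends G e|.
Proof.
rewrite /degree.
rewrite (exchange_big_dep (mem (edges G))) /=; last first.
  by move=> v e _; rewrite inE => /andP[].
apply: eq_bigr => e eG; rewrite sum_nat_const mulnC; congr (_ * _).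
by apply: eq_card => v; rewrite !inE unfold_in inE eG.
Qed.

Let handshake G : \sum_(v in vertices G) degree G v = 2 * #|edges G|.
Proof.
rewrite sum_degree mulnC -sum_nat_const; apply: eq_bigr => e eG.
by rewrite (setIidPr _) ?w_ends //; case/andP: (endsP eG).
Qed.

Let degree_gt0 G v : reflect (exists2 e, e \in edges G & v \in ends G e)
  (degree G v != 0).
Proof.
rewrite /degree sum_nat_eq0 negb_forall_in.
apply: (iffP existsP) => [[e /andP[]]|[e eG ve]].
  by rewrite inE => /andP[eG ve] _; exists e.
by exists e; rewrite inE eG ve /=; case: ifP.
Qed.

Let adj_sym G : symmetric (adj G).
Proof.
by move=> u v; apply/existsP/existsP => -[e /and3P[eG ? ?]];
  exists e; apply/and3P.
Qed.

Let adjI G e u v : e \in edges G -> u \in ends G e -> v \in ends G e ->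
  adj G u v.
Proof. by move=> eG ue ve; apply/existsP; exists e; apply/and3P. Qed.

Let comp_ends G v e u : e \in edges G -> u \in ends G e ->
  u \in component_vertices G v -> ends G e \subset component_vertices G v.
Proof.
move=> eG ue; rewrite inE => /andP[_ vu]; apply/subsetP => z ze.
have /andP[/subsetP/(_ z ze) zG _] := endsP eG.
by rewrite inE zG (connect_trans vu) // connect1 // (adjI eG).
Qed.

Let comp_degree G v u : u \in component_vertices G v ->
  degree (component G v) u = degree G u.
Proof.
move=> uc; apply: eq_bigl => e; rewrite !inE /=.
apply/andP/andP => -[] => [/andP[] //|eG ue].
by split=> //; rewrite eG; apply: comp_ends uc.
Qed.

Let comp_connected G v : v \in vertices G -> graph_connected (component G v).
Proof.
move=> vG; have vc : v \in component_vertices G v by rewrite inE vG connect0.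
apply/andP; split; first by apply/set0Pn; exists v.
have key u : u \in component_vertices G v -> connect (adj (component G v)) v u.
  rewrite inE => /andP[_ /connectP[p]].
  elim/last_ind: p u => [u _ ->|p z IH u] //=.
  rewrite rcons_path last_rcons => /andP[pth az] ->.
  apply: (connect_trans (IH _ pth erefl)); apply: connect1.
  case/existsP: az => e /and3P[eG le ze].
  apply: (@adjI (component G v) e) => //=; rewrite inE eG /=.
  apply: (comp_ends eG le); rewrite inE.
  have /andP[/subsetP/(_ _ le) -> _] := endsP eG.
  by apply/connectP; exists p.
apply/forall_inP => a /key va; apply/forall_inP => b /key; apply: connect_trans.
by rewrite (sym_connect_sym (@adj_sym _)).
Qed.

Let VX G X := vertices (edge_subgraph G X).

Let VXP G X v :
  reflect (exists2 e, e \in X :&: edges G & v \in ends G e) (v \in VX G X).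
Proof. exact: bigcupP. Qed.

Let VXS G X Y : X \subset Y -> VX G X \subset VX G Y.
Proof.
move=> /subsetP XY; apply/subsetP => v /VXP[e /setIP[eX eG] ve].
by apply/VXP; exists e => //; rewrite inE XY.
Qed.

Let bowtie_strict G X Y : X \subset edges G -> bowtie (edge_subgraph G X) ->
  Y \proper X -> #|Y| + #|VX G X| < #|X| + #|VX G Y|.
Proof.
move=> XG bX /properP[YX [e0 e0X e0Y]].
set H := edge_subgraph G X in bX.
have HE : edges H = X by apply/setIidPl.
case/and3P: bX => /forall_inP noI /forall_inP noL /forall_inP noC.
pose W := VX G X :\: VX G Y; pose D := X :\: Y.
have cW : #|W| + #|VX G Y| = #|VX G X|.
  by rewrite -(cardsID (VX G Y) (VX G X)) (setIidPr (VXS G YX)) addnC.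
have cD : #|D| + #|Y| = #|X|.
  by rewrite -(cardsID Y X) (setIidPr YX) addnC.
have inD e v : e \in X -> v \in ends G e -> v \in W -> e \in D.
  move=> eX ve; rewrite /W !inE eX andbT => /andP[vY _].
  apply: contra vY => eY; apply/VXP; exists e => //.
  by rewrite inE eY (subsetP XG).
have deg2 v : v \in W -> 2 <= degree H v.
  rewrite inE => /andP[_ vX].
  by have := noI v vX; have := noL v vX; case: degree => [|[]].
have wle e : e \in X -> w H e * #|W :&: ends H e| <= 2 ?= iff (ends H e \subset W).
  rewrite -HE => eH; have we := w_ends eH.
  have w0 : 0 < w H e by rewrite /w; case: ifP.
  suff : w H e * #|W :&: ends H e| <= w H e * #|ends H e| ?= iff
      (ends H e \subset W) by rewrite we.
  split.
    by rewrite leq_pmul2l // subset_leq_card // subsetIr.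
  rewrite eqn_pmul2l // (sameP setIidPr eqP).
  by rewrite eqEcard subsetIr /= eqn_leq subset_leq_card ?subsetIr.
have sumD : \sum_(v in W) degree H v = \sum_(e in D) w H e * #|W :&: ends H e|.
  rewrite sum_degree HE (big_setID Y) /= (setIidPr YX) big1 // => e eY.
  rewrite (_ : _ :&: _ = set0) ?cards0 ?muln0 //.
  apply/setP => v; rewrite in_set0; apply/negbTE/negP => /setIP[vW ve].
  by have := inD e v (subsetP YX _ eY) ve vW; rewrite inE eY.
have lb : 2 * #|W| <= \sum_(v in W) degree H v ?= iff
    [forall (v | v \in W), 2 == degree H v].
  rewrite mulnC -sum_nat_const; apply: leqif_sum => v vW.
  by split=> //; apply: deg2.
have ub : \sum_(v in W) degree H v <= 2 * #|D| ?= iff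
    [forall (e | e \in D), ends H e \subset W].
  rewrite sumD mulnC -sum_nat_const; apply: leqif_sum => e.
  by rewrite inE => /andP[_]; apply: wle.
have tot := leqif_trans lb ub.
case: (ltngtP #|W| #|D|) => [lt|gt|eqWD]; first by lia.
  by have := tot.1; lia.
have := tot.2; rewrite eqWD eqxx => /esym/andP[/forall_inP all2 /forall_inP allW].
have e0D : e0 \in D by rewrite inE e0X e0Y.
have e0H : e0 \in edges H by rewrite HE.
have /andP[_ /andP[/card_gt0P[v0 v0e] _]] := endsP e0H.
have v0W : v0 \in W := subsetP (allW _ e0D) _ v0e.
have v0H : v0 \in vertices H by move: v0W; rewrite inE => /andP[].
have /negP[] := noC v0 v0H.
rewrite /is_cycle comp_connected //=; apply/forall_inP => u uc.
rewrite comp_degree // eq_sym; apply: all2.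
move: uc; rewrite inE => /andP[_ /connectP[p]].
elim/last_ind: p u => [u _ ->|p z IH u] //=.
rewrite rcons_path last_rcons => /andP[pth az] ->.
have lW := IH _ pth erefl.
case/existsP: az => e /and3P[]; rewrite HE => eX le ze.
exact: (subsetP (allW _ (inD e _ eX le lW)) _ ze).
Qed.

Let dense (k : nat) G X := (X \subset edges G) && (#|VX G X| + k <= #|X|).

Let DeltaE (k : nat) G X : X \subset edges G ->
  (Delta (edge_subgraph G X) == k%:Z)%R = (#|VX G X| + k == #|X|).
Proof.
move=> XG; rewrite /Delta -/(VX G X) /= (setIidPl XG).
by apply/eqP/eqP; lia.
Qed.

Let min_dense (k : nat) G X : 0 < k -> minset (dense k G) X ->
  X \in kcircuits k G.
Proof.
move=> k0 /minsetP[/andP[XG Xd] minX].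
have no Y : Y \proper X -> #|Y| < #|VX G Y| + k.
  move=> YX; rewrite ltnNge; apply/negP => dY.
  have YE : Y = X.
    apply: minX; last exact: proper_sub.
    by rewrite /dense dY (subset_trans (proper_sub YX) XG).
  by rewrite YE properxx in YX.
set H := edge_subgraph G X.
have HE : edges H = X by apply/setIidPl.
have [e0 e0X] : exists e, e \in X by apply/set0Pn; rewrite -card_gt0; lia.
have D1 e : e \in X -> X :\ e \proper X /\ #|X| = #|X :\ e|.+1.
  by move=> eX; rewrite properD1 // (cardsD1 e) eX.
rewrite inE XG DeltaE //=; apply/andP; split.
  rewrite eqn_leq Xd /=.
  have [/no lt ->] := D1 _ e0X.
  by have /subset_leq_card := VXS G (subD1set X e0); lia.
apply/and3P; split; apply/forall_inP => v vH.
- by apply/degree_gt0; apply/VXP: vH.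
- apply/negP => /eqP deg1.
  have /degree_gt0[e eH ve] : degree H v != 0 by rewrite deg1.
  have eX : e \in X by rewrite -HE.
  have es : e \in star v H by rewrite inE eH.
  move: deg1; rewrite /degree (big_setD1 e es) /= => deg1.
  have uniq f : f \in X -> v \in ends G f -> f = e.
    move=> fX vf; apply/eqP; apply: contraTT isT => fe.
    have fs : f \in star v H :\ e by rewrite in_setD1 fe inE HE fX.
    by move: deg1; rewrite (big_setD1 f fs) /=; do 2!case: ifP => _; lia.
  have [/no lt cX] := D1 _ eX.
  have sub : VX G (X :\ e) \subset VX G X :\ v.
    apply/subsetP => u uV; rewrite in_setD1 (subsetP (VXS G (subD1set X e))) //.
    rewrite andbT; apply: contraTneq uV => ->; apply/negP => /VXP[f].
    rewrite !inE => /andP[/andP[fe fX] _] vf.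
    by rewrite (uniq f) ?eqxx in fe.
  have := subset_leq_card sub; have := cardsD1 v (VX G X).
  by rewrite (vH : v \in VX G X); lia.
- apply/negP => /andP[_ /forall_inP all2].
  set W := vertices (component H v) in all2.
  pose D := edges (component H v).
  have DX : D \subset X by rewrite -HE; apply/subsetP => e; rewrite inE => /andP[].
  have cDW : #|D| = #|W|.
    have := handshake (component H v).
    rewrite (eq_bigr (fun=> 2)) => [|u /all2/eqP //].
    by rewrite sum_nat_const -/D -/W; lia.
  have vW : v \in W by rewrite inE vH connect0.
  have WX : W \subset VX G X by apply/subsetP => u; rewrite inE => /andP[].
  have W0 : 0 < #|W| by apply/card_gt0P; exists v.
  have cX : #|X :\: D| + #|D| = #|X|.
    by rewrite -(cardsID D X) (setIidPr DX) addnC.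
  have cV : #|VX G X :\: W| + #|W| = #|VX G X|.
    by rewrite -(cardsID W (VX G X)) (setIidPr WX) addnC.
  have sub : VX G (X :\: D) \subset VX G X :\: W.
    apply/subsetP => u uV; rewrite in_setD (subsetP (VXS G (subsetDl X D))) //.
    rewrite andbT; case/VXP: uV => e; rewrite in_setI in_setD.
    move=> /andP[/andP[eD eX] _] ue; apply: contra eD => uW.
    have eH : e \in edges H by rewrite HE.
    by rewrite inE eH; apply: (comp_ends eH ue uW).
  have /no : X :\: D \proper X by rewrite properEcard subsetDl; lia.
  by have := subset_leq_card sub; lia.
Qed.

Section KCircularMatroid.
Variables (k : nat) (k_gt0 : 0 < k) (G : graph V E).

Fact kcircuit_sub C : C \in kcircuits k G -> C \subset edges G.
Proof. by rewrite inE => /andP[]. Qed.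

Let kcircuit_card C : C \in kcircuits k G -> #|VX G C| + k = #|C|.
Proof. by rewrite inE => /and3P[CG dC _]; apply/eqP; rewrite -DeltaE. Qed.

Let kcircuit_proper C Y : C \in kcircuits k G -> Y \proper C ->
  #|Y| < #|VX G Y| + k.
Proof.
move=> Cc; have := kcircuit_card Cc; move: Cc.
by rewrite inE => /and3P[CG _ bC] cC /(bowtie_strict CG bC); lia.
Qed.

Fact kcircuit_neq0 : set0 \notin kcircuits k G.
Proof. by apply/negP => /kcircuit_card; rewrite cards0; lia. Qed.

Fact kcircuit_min C1 C2 : C1 \in kcircuits k G -> C2 \in kcircuits k G ->
  C1 \subset C2 -> C1 = C2.
Proof.
move=> c1 c2; rewrite subEproper => /predU1P[//|/(kcircuit_proper c2)].
by rewrite -(kcircuit_card c1) ltnn.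
Qed.

Fact kcircuit_elim C1 C2 e : C1 \in kcircuits k G -> C2 \in kcircuits k G ->
  C1 != C2 -> e \in C1 :&: C2 ->
  exists2 C3, C3 \in kcircuits k G & C3 \subset (C1 :|: C2) :\ e.
Proof.
move=> c1 c2 neq eC.
have pI : C1 :&: C2 \proper C1.
  rewrite properE subsetIl subsetI subxx /=.
  by apply: contra neq => /(kcircuit_min c1 c2) ->.
have lt := kcircuit_proper c1 pI.
have e1 := kcircuit_card c1; have e2 := kcircuit_card c2.
have UG : C1 :|: C2 \subset edges G by rewrite subUset !kcircuit_sub.
have VU : VX G (C1 :|: C2) \subset VX G C1 :|: VX G C2.
  apply/subsetP => v /VXP[f]; rewrite in_setI in_setU in_setU.
  move=> /andP[/orP[] fC fG] vf; apply/orP; [left|right];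
  by apply/VXP; exists f; rewrite // inE fC.
have VI : VX G (C1 :&: C2) \subset VX G C1 :&: VX G C2.
  by rewrite subsetI !VXS ?subsetIl ?subsetIr.
have eU : e \in C1 :|: C2 by move: eC; rewrite !inE => /andP[->].
have /minset_exists[C3 minC3 C3s] : dense k G ((C1 :|: C2) :\ e).
  rewrite /dense (subset_trans (subD1set _ _) UG) /=.
  have := cardsUI C1 C2; have := cardsUI (VX G C1) (VX G C2).
  have := subset_leq_card VU; have := subset_leq_card VI.
  have := subset_leq_card (VXS G (subD1set (C1 :|: C2) e)).
  by have := cardsD1 e (C1 :|: C2); rewrite eU; lia.
by exists C3 => //; apply: min_dense.
Qed.

Definition kcircular : matroid E :=
  Matroid kcircuit_sub kcircuit_neq0 kcircuit_min kcircuit_elim.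

End KCircularMatroid.

End KCircular.

(* Main.v *)
Require Import Defs.
From mathcomp Require Import all_boot all_order all_algebra.
From mathcomp Require Import zify.

Set Implicit Arguments.
Unset Strict Implicit.
Unset Printing Implicit Defensive.

Import Order.TTheory GRing.Theory Num.Theory.

(* Bowtie edge sets (of positive excess |X| - |V(X)|) are exactly those whose
   proper subsets all have smaller excess, and the excess is
   supermodular; circuits of M_k are the sets of this kind with excess k.  Such
   a set Z of excess at least k has rank |V(Z)| + k - 1, so if the complement Z
   of a cocircuit K is connected, hence a union of circuits, it spans all
   vertices but one, x, and K is the star of x.  Conversely, the complement of
   the star is then a hyperplane, and it is connected because a set of excess
   m + 1 >= 3 can be shrunk to excess m while keeping two prescribed edges.
   This descent stops at excess 2: for k = 1 one links edges through shared
   vertices instead, which is where connectivity of the graph enters. *)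

(** * Critical sets of a supermodular excess function *)

Section Supermodular.

Context {E : finType} (d : {set E} -> int).
Implicit Types (A B C X Y Z : {set E}) (e f g h : E) (n : int).

Definition critical X : Prop := forall Y, Y \proper X -> (d Y < d X)%R.

(** The last property bounds the contribution of one element by one, so that the descents below can
    reach every intermediate integer. *)
Definition excess_function : Prop :=
  [/\ d set0 = 0%R,
      forall A B, (d A + d B <= d (A :|: B) + d (A :&: B))%R
    & forall X e, (d X <= d (X :\ e) + 1)%R].

Lemma critical_eq X Y : critical X -> Y \subset X -> (d X <= d Y)%R -> Y = X.
Proof.
move=> cX; rewrite subEproper => /predU1P[//|/cX].
by rewrite ltNge => /negP.
Qed.

Lemma critical_le X Y : critical X -> Y \subset X -> (d Y <= d X)%R.
Proof.
by move=> cX; rewrite subEproper => /predU1P[-> //|/cX /ltW].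
Qed.

Hypothesis d_excess : excess_function.

Let d_set0 : d set0 = 0%R. Proof. by case: d_excess. Qed.

Let d_supermodular A B : (d A + d B <= d (A :|: B) + d (A :&: B))%R.
Proof. by case: d_excess. Qed.

Let d_setD1 X e : (d X <= d (X :\ e) + 1)%R.
Proof. by case: d_excess. Qed.

Lemma critical_setD1 X e : critical X -> e \in X -> d (X :\ e) = (d X - 1)%R.
Proof.
move=> cX eX; have := d_setD1 X e; have := cX _ (properD1 eX); lia.
Qed.

(** A minimal subset of excess at least [n] works: minimality makes it critical, and since one
    deletion costs at most one, its excess cannot exceed [n]. The hypothesis [0 < n] keeps it
    nonempty. *)
Lemma critical_sub X n : (0 < n)%R -> (n <= d X)%R ->
  exists2 Z : {set E}, Z \subset X & critical Z /\ d Z = n.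
Proof.
move=> n0 nX; pose P (Z : {set E}) := (n <= d Z)%R.
have /minset_exists[Z /minsetP[PZ minZ] ZX] : P X by [].
have small Y : Y \proper Z -> (d Y < n)%R.
  move=> YZ; rewrite ltNge; apply/negP => PY.
  by move: (YZ); rewrite (minZ Y PY (proper_sub YZ)) properxx.
exists Z => //.
have dZ : d Z = n.
  have [Z0|[e eZ]] := set_0Vmem Z; first by move: PZ; rewrite /P Z0 d_set0; lia.
  by have := small _ (properD1 eZ); have := d_setD1 Z e; move: PZ; rewrite /P; lia.
by split=> // Y /small; rewrite dZ.
Qed.

(** If [Y] misses some [e] in [Z], it meets the critical [C] around [e] in a proper subset of [C],
    so supermodularity gives [d Y < d (Y :|: C)]. Repeating this climbs strictly up to [Z]. *)
Lemma critical_cover Z :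
    (forall e, e \in Z -> exists C, [/\ critical C, e \in C & C \subset Z]) ->
  critical Z.
Proof.
move=> cov; suff main m Y : #|Z :\: Y| <= m -> Y \subset Z ->
    (d Y <= d Z)%R /\ (Y \proper Z -> (d Y < d Z)%R).
  by move=> Y YZ; have [_ ->] := main _ Y (leqnn _) (proper_sub YZ).
elim: m Y => [|m IH] Y cm YZ.
  have ZY : Y = Z.
    apply/eqP; rewrite eqEsubset YZ -setD_eq0 -cards_eq0.
    by move: cm; rewrite leqn0.
  by rewrite ZY properxx.
have [->|YZ'] := eqVneq Y Z; first by rewrite properxx.
have pYZ : Y \proper Z by rewrite properEneq YZ'.
have /properP[_ [e eZ eY]] := pYZ.
suff : (d Y < d Z)%R by move=> lt; split=> // ; apply: ltW.
have [C [cC eC CZ]] := cov e eZ.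
have pI : Y :&: C \proper C.
  by apply/properP; split; [exact: subsetIr | exists e; rewrite // inE (negbTE eY)].
have [] := IH (Y :|: C).
- rewrite -ltnS; apply: leq_trans cm; apply: proper_card; apply/properP; split.
    by apply: setDS; apply: subsetUl.
  by exists e; rewrite !inE ?eZ ?eY ?eC ?orbT.
- by rewrite subUset YZ.
by have := cC _ pI; have := d_supermodular Y C; lia.
Qed.

Lemma criticalU X Y : critical X -> critical Y -> critical (X :|: Y).
Proof.
move=> cX cY; apply: critical_cover => e; rewrite inE => /orP[] eXY.
  by exists X; rewrite subsetUl.
by exists Y; rewrite subsetUr.
Qed.

(* Deleting [g] forces [e] out of a subset of excess [d X - 1] only if [e] and
   [g] are in series; a critical [A] avoiding [e] and containing [g] shows that
   they are not. *)
Lemma critical_mem X A Z e g : critical X -> e \in X ->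
    critical A -> A \subset X :\ e -> g \in A -> Z \subset X :\ g ->
    (d X <= d Z + 1)%R ->
  e \in Z.
Proof.
move=> cX eX cA AX gA ZX dZ; apply: contraT => eZ.
have pU : Z :|: A \proper X.
  apply: sub_proper_trans (properD1 eX); rewrite subUset AX subsetD1 eZ.
  by rewrite (subset_trans ZX (subD1set _ _)).
have pI : Z :&: A \proper A.
  apply/properP; split; first exact: subsetIr.
  by exists g => //; apply/negP => /setIP[/(subsetP ZX)]; rewrite !inE eqxx.
by have := cX _ pU; have := cA _ pI; have := d_supermodular Z A; lia.
Qed.

(** Take [A] avoiding [e] and [B] avoiding [f], both critical of excess [n]. For [g] in both, any
    set of excess [n] inside [X :\ g] contains [e] and [f] by [critical_mem]. *)
Lemma critical_descent X n e f : critical X -> d X = (n + 1)%R -> (0 < n)%R ->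
    e \in X -> f \in X -> (1 < n)%R \/ e = f ->
  exists2 Z : {set E}, Z \subset X & [/\ critical Z, d Z = n, e \in Z & f \in Z].
Proof.
move=> cX dX n0 eX fX nef.
have sub g : g \in X -> exists2 Z : {set E}, Z \subset X :\ g & critical Z /\ d Z = n.
  by move=> gX; apply: critical_sub; rewrite // critical_setD1 // dX; lia.
have [A AX [cA dA]] := sub e eX.
have [B BX [cB dB]] := sub f fX.
have [g [gA [B' B'X [[cB' dB'] gB']]]] : exists g, g \in A /\ 
    exists2 B : {set E}, B \subset X :\ f & [/\ critical B /\ d B = n & g \in B].
  (* When [e = f], the set [A] itself plays the part of [B]. *)
  case: nef => [n1|<-]; last first.
    have [A0|[g gA]] := set_0Vmem A; first by move: dA; rewrite A0 d_set0; lia.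
    by exists g; split=> //; exists A.
  (* Disjoint [A] and [B] would give [2 * n <= d (A :|: B) <= n + 1], impossible for [n > 1]. *)
  have [AB0|[g]] := set_0Vmem (A :&: B); last first.
    by rewrite inE => /andP[gA gB]; exists g; split=> //; exists B.
  have UX : A :|: B \subset X.
    by rewrite subUset (subset_trans AX) ?(subset_trans BX) ?subD1set.
  have := critical_le cX UX; have := d_supermodular A B; rewrite AB0 d_set0; lia.
have gX : g \in X by have := subsetP AX _ gA; rewrite inE => /andP[].
have [Z ZX [cZ dZ]] := sub g gX.
exists Z; first exact: subset_trans ZX (subD1set _ _).
split=> //; first by apply: (critical_mem cX eX cA AX gA ZX); lia.
by apply: (critical_mem cX fX cB' B'X gB' ZX); lia.
Qed.

Lemma critical_common X n e f : critical X -> (0 < n)%R -> (n <= d X)%R ->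
    e \in X -> f \in X -> (1 < n)%R \/ e = f ->
  exists2 C : {set E}, C \subset X & [/\ critical C, d C = n, e \in C & f \in C].
Proof.
move=> cX n0 nX eX fX nef; move: {2}(absz (d X - n)%R) (leqnn (absz (d X - n)%R)) => m.
elim: m X cX nX eX fX => [|m IH] X cX nX eX fX dm.
  by exists X => //; split=> //; lia.
have [dX|dX] := eqVneq (d X) n; first by exists X.
have [|||Z ZX [cZ dZ eZ fZ]] := @critical_descent X (d X - 1)%R e f cX _ _ eX fX.
- lia.
- lia.
- by case: nef => [n1|->]; [left; lia | right].
have [||C CZ cC] := IH Z cZ _ eZ fZ; try lia.
by exists C => //; apply: subset_trans CZ ZX.
Qed.

(** This is strong circuit elimination. The set [C2] contains [h] and avoids [e], so [critical_mem]
    keeps [e] in a subset of [X :\ h] of excess [d X - 1], which is then shrunk to excess one around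
    [e]. *)
Lemma critical_strong_elim C1 C2 e h : critical C1 -> critical C2 ->
    d C1 = 1%R -> d C2 = 1%R -> h \in C1 :&: C2 -> e \in C1 :\: C2 ->
  exists2 C : {set E}, C \subset (C1 :|: C2) :\ h & [/\ critical C, d C = 1%R & e \in C].
Proof.
move=> c1 c2 d1 d2 /setIP[h1 h2] /setDP[e1 e2].
set X := C1 :|: C2; have cX : critical X := criticalU c1 c2.
have hX : h \in X by rewrite inE h1.
have eX : e \in X by rewrite inE e1.
have C2X : C2 \proper X by apply/properP; split; [exact: subsetUr|exists e].
have d2X := cX _ C2X.
have [||Z ZX [cZ dZ]] := @critical_sub (X :\ h) (d X - 1)%R.
- lia.
- by rewrite critical_setD1.
have eZ : e \in Z.
  apply: (critical_mem cX eX c2 _ h2 ZX); last by lia.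
  by rewrite subsetD1 e2 subsetUr.
have [||C CZ [cC dC eC _]] := critical_common cZ (n := 1%R) isT _ eZ eZ.
- lia.
- by right.
by exists C => //; apply: subset_trans CZ ZX.
Qed.

(** Transitivity of lying on a common circuit, by induction on the size of the union: eliminating
    [h] in favour of [e] and of [f] gives [C3] and [C4], from which a meeting pair with smaller
    union is extracted. *)
Lemma critical_trans C1 C2 e f : critical C1 -> critical C2 ->
    d C1 = 1%R -> d C2 = 1%R -> C1 :&: C2 != set0 -> e \in C1 -> f \in C2 ->
  exists2 C : {set E}, C \subset C1 :|: C2 &
    [/\ critical C, d C = 1%R, e \in C & f \in C].
Proof.
move: {2}#|C1 :|: C2| (leqnn #|C1 :|: C2|) => m.
elim: m C1 C2 => [|m IH] C1 C2 cm c1 c2 d1 d2 /set0Pn[h hI] e1 f2.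
  by move: cm; rewrite leqn0 cards_eq0 => /eqP U0; have := in_setU e C1 C2; rewrite U0 inE e1.
have [e2|e2] := boolP (e \in C2); first by exists C2; rewrite ?subsetUr.
have [f1|f1] := boolP (f \in C1); first by exists C1; rewrite ?subsetUl.
have [h1 h2] := setIP hI.
have IHU A B : A :|: B \proper C1 :|: C2 -> critical A -> critical B ->
    d A = 1%R -> d B = 1%R -> A :&: B != set0 -> e \in A -> f \in B ->
    exists2 C : {set E}, C \subset C1 :|: C2 &
      [/\ critical C, d C = 1%R, e \in C & f \in C].
  move=> AB cA cB dA dB AB0 eA fB.
  have [|C CAB CP] := IH A B _ cA cB dA dB AB0 eA fB.
    by rewrite -ltnS; apply: leq_trans (proper_card AB) cm.
  by exists C => //; apply: subset_trans CAB (proper_sub AB).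
have eD : e \in C1 :\: C2 by rewrite inE e2.
have fD : f \in C2 :\: C1 by rewrite inE f1.
have hI' : h \in C2 :&: C1 by rewrite setIC.
have [C3 /subsetD1P[C3U h3] [c3 d3 e3]] :=
  critical_strong_elim c1 c2 d1 d2 hI eD.
have [C4 /subsetD1P[]] := critical_strong_elim c2 c1 d2 d1 hI' fD.
rewrite setUC => C4U h4 [c4 d4 f4].
have out A B : critical A -> critical B -> d A = 1%R -> d B = 1%R ->
    h \in B -> h \notin A -> exists2 y, y \in A & y \notin B.
  move=> cA cB dA dB hB hA; apply/subsetPn; apply: contra hA => AB.
  by rewrite (critical_eq cB AB) // dA dB.
have [y y3 y1] := out _ _ c3 c1 d3 d1 h1 h3.
have [z z4 z2] := out _ _ c4 c2 d4 d2 h2 h4.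
have y2 : y \in C2 by have := subsetP C3U _ y3; rewrite inE (negbTE y1).
have z1 : z \in C1 by have := subsetP C4U _ z4; rewrite inE (negbTE z2) orbF.
(* Either [C1] and [C4], which meet in [z], have a smaller union, or [C4] contains all of
   [C2 :\: C1]; then [C3] and [C4] meet in [y] and their union misses [h]. *)
have [pU|] := boolP (C1 :|: C4 \proper C1 :|: C2).
  by apply: (IHU C1 C4) => //; apply/set0Pn; exists z; rewrite inE z1.
rewrite properE subUset subsetUl C4U negbK => /subsetP U4.
have y4 : y \in C4.
  by have := U4 y; rewrite !inE y2 orbT (negbTE y1); apply.
apply: (IHU C3 C4) => //; last by apply/set0Pn; exists y; rewrite inE y3.
apply/properP; split; first by rewrite subUset C3U C4U.
by exists h; rewrite !inE ?h1 // negb_or h3.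
Qed.

End Supermodular.

(** * Circuits, bases and coindependence in a matroid *)

Section MatroidTheory.

Context {E : finType} (M : matroid E).
Implicit Types (I J B C Z : {set E}) (e f : E).

Lemma indepS I J : J \subset I -> indep M I -> indep M J.
Proof.
move=> JI /andP[IM /forall_inP cI]; rewrite /indep (subset_trans JI) //=.
by apply/forall_inP => C /cI; apply: contra => CJ; apply: subset_trans CJ JI.
Qed.

Lemma dependent_circuit I : I \subset ground M -> ~~ indep M I ->
  exists2 C, C \in circuits M & C \subset I.
Proof.
rewrite /indep => ->; rewrite negb_forall_in => /exists_inP[C CM].
by rewrite negbK; exists C.
Qed.

Lemma circuit_dependent C I : C \in circuits M -> C \subset I -> ~~ indep M I.
Proof.
by move=> CM CI; apply/negP => /andP[_ /forall_inP/(_ C CM)]; rewrite CI.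
Qed.

Lemma indep_basis I : indep M I -> exists2 B : {set E}, basis M B & I \subset B.
Proof. by move=> /maxset_exists[B]; exists B. Qed.

Lemma basis_indep B : basis M B -> indep M B.
Proof. exact: maxsetp. Qed.

(** If a basis [B] misses [e], then [e |: B] contains a circuit through [e]; conversely, a basis
    extending [C :\ e] cannot contain [e]. *)
Lemma coloopPn e : e \in ground M ->
  ~~ coloop M e <-> exists2 C, C \in circuits M & e \in C.
Proof.
move=> eM; rewrite /coloop eM negb_forall; split.
  case/existsP => B; rewrite negb_imply => /andP[bB eB].
  have BM : B \subset ground M by case/andP: (basis_indep bB).
  have [||C CM CeB] := @dependent_circuit (e |: B).
  - by rewrite subUset sub1set eM.
  - apply: contra eB => iB.
    by rewrite -(maxsetsup bB iB (subsetUr _ _)) setU11.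
  exists C => //; apply: contraTT (basis_indep bB) => eC.
  by apply: (circuit_dependent CM); rewrite -(setU1K eB) subsetD1 CeB.
case=> C CM eC; have iC : indep M (C :\ e).
  have CgM := circuit_sub CM.
  apply: contraT => /dependent_circuit[|D DM DC].
    by apply: subset_trans CgM; apply: subD1set.
  have := circuit_min DM CM (subset_trans DC (subD1set _ _)) => DE.
  by have := subsetP DC e; rewrite DE eC !inE eqxx => /(_ isT).
have [B bB CB] := indep_basis iC; apply/existsP; exists B.
rewrite bB /=; apply: contraTN (basis_indep bB) => eB.
by apply: (circuit_dependent CM); rewrite -(setD1K eC) subUset sub1set eB.
Qed.

Lemma coindepPn I : I \subset ground M ->
  reflect (forall B, basis M B -> ~~ [disjoint B & I]) (~~ coindep M I).
Proof.
move=> IM; rewrite /coindep negb_exists.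
apply: (iffP forallP) => hit B; last first.
  rewrite negb_and; case: (boolP (basis M B)) => //= /hit.
  by apply: contra; rewrite subsetD disjoint_sym => /andP[].
move=> bB; have := hit B; rewrite bB /=; apply: contra => BI.
by rewrite subsetD IM disjoint_sym.
Qed.

End MatroidTheory.

(** * Degrees and components of graphs *)

Section GraphTheory.

Context {V E : finType}.
Implicit Types (G H : graph V E) (u v x : V) (e f : E) (X Y Z C : {set E}).

(** Graph records also carry the proof [endsP]; comparing their data alone lets a vertex deletion be
    identified with an edge subgraph. *)
Lemma bowtie_ext G H : vertices G = vertices H -> edges G = edges H ->
  ends G = ends H -> bowtie G = bowtie H.
Proof. by case: G H => [vG eG dG pG] [vH eH dH pH] /= eqV eqE eqD; subst. Qed.

Lemma graph_connected_ext G H : vertices G = vertices H ->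
  edges G = edges H -> ends G = ends H ->
  graph_connected G = graph_connected H.
Proof. by case: G H => [vG eG dG pG] [vH eH dH pH] /= eqV eqE eqD; subst. Qed.

Lemma handshake G : \sum_(v in vertices G) degree G v = 2 * #|edges G|.
Proof.
rewrite /degree (exchange_big_dep (mem (edges G))) /=; last first.
  by move=> v e _; rewrite inE => /andP[].
rewrite mulnC -sum_nat_const; apply: eq_bigr => e eG.
have /andP[/subsetP endsV card_ends] := endsP eG; rewrite sum_nat_const.
rewrite (@eq_card _ _ (mem (ends G e))); last first.
  move=> v; rewrite unfold_in /= inE eG /=.
  by apply/andP/idP => [[] //|ve]; split=> //; apply: endsV.
by move: card_ends; rewrite /is_loop; case: #|_| => [|[|[|]]].
Qed.

Lemma star_degree G v : #|star v G| <= degree G v.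
Proof. by rewrite -sum1_card; apply: leq_sum => e _; case: ifP. Qed.

Lemma degree_eq0 G v : (degree G v == 0) = (star v G == set0).
Proof.
apply/idP/idP => [|/eqP s0]; last by rewrite /degree s0 big_set0.
by rewrite -cards_eq0 -!leqn0; apply: leq_trans; apply: star_degree.
Qed.

Lemma adjI G e u v : e \in edges G -> u \in ends G e -> v \in ends G e ->
  adj G u v.
Proof. by move=> eG ue ve; apply/existsP; exists e; apply/and3P. Qed.

Lemma component_ends G v e u : e \in edges G -> u \in ends G e ->
  u \in component_vertices G v -> ends G e \subset component_vertices G v.
Proof.
move=> eG ue; rewrite inE => /andP[_ vu]; apply/subsetP => z ze.
have /andP[/subsetP/(_ z ze) zG _] := endsP eG.
by rewrite inE zG (connect_trans vu) // connect1 // (adjI eG ue ze).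
Qed.

End GraphTheory.

(** * The excess of an edge set and bowtie subgraphs *)

Section Excess.

Context {V E : finType} (G : graph V E).
Implicit Types (u v x : V) (e f : E) (X Y Z C : {set E}) (n : int).

Local Notation span X := (vertices (edge_subgraph G X)).

Definition excess X : int := Delta (edge_subgraph G X).

Lemma excessE X : X \subset edges G -> excess X = (#|X|%:Z - #|span X|%:Z)%R.
Proof. by move=> XG; rewrite /excess /Delta /= (setIidPl XG). Qed.

Lemma spanP X v : X \subset edges G ->
  reflect (exists2 e, e \in X & v \in ends G e) (v \in span X).
Proof. by move=> XG; rewrite /= (setIidPl XG); apply: bigcupP. Qed.

Lemma spanS X Y : X \subset Y -> span X \subset span Y.
Proof.
move=> XY; apply/bigcupsP => e eX; apply: bigcup_sup.
by apply: (subsetP _ _ eX); apply: setSI.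
Qed.

Lemma spanU X Y : span (X :|: Y) = span X :|: span Y.
Proof. by rewrite /= setIUl bigcup_setU. Qed.

Lemma span_edges : no_isolated G -> span (edges G) = vertices G.
Proof.
move=> /forall_inP noI; apply/eqP; rewrite eqEsubset; apply/andP; split.
  by apply/bigcupsP => e; rewrite setIid => /endsP/andP[].
apply/subsetP => v vG; have := noI v vG; rewrite degree_eq0 => /set0Pn[e].
by rewrite inE => /andP[eG ve]; apply/spanP => //; exists e.
Qed.

Lemma span_ends X e : X \subset edges G -> e \in X -> ends G e \subset span X.
Proof. by move=> XG eX; rewrite /= (setIidPl XG); apply: bigcup_sup. Qed.

Lemma span_vertices X : span X \subset vertices G.
Proof. by apply/bigcupsP => e /setIP[_ /endsP/andP[]]. Qed.

Lemma span_neq0 X : X \subset edges G -> X != set0 -> span X != set0.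
Proof.
move=> XG /set0Pn[e eX]; have /andP[_ /andP[/card_gt0P[v ve] _]] := endsP (subsetP XG e eX).
by apply/set0Pn; exists v; apply/spanP => //; exists e.
Qed.

(** The defect in supermodularity is the number of vertices common to both spans but outside the
    span of the common edges. The exact value matters later for disjoint edge sets. *)
Lemma excess_setU_setI X Y :
  (excess (X :|: Y) + excess (X :&: Y) + #|span (X :&: Y)|%:Z =
    excess X + excess Y + #|span X :&: span Y|%:Z)%R.
Proof.
have spU := spanU X Y.
have := cardsUI (X :&: edges G) (Y :&: edges G).
have := cardsUI (span X) (span Y); rewrite -spU -setIUl -setIIl.
rewrite /excess /Delta.
rewrite [edges (edge_subgraph G (X :|: Y))]/= [edges (edge_subgraph G (X :&: Y))]/=.
rewrite [edges (edge_subgraph G X)]/= [edges (edge_subgraph G Y)]/=.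
lia.
Qed.

Lemma excess0 : excess set0 = 0%R.
Proof. by rewrite excessE ?sub0set //= set0I big_set0 !cards0. Qed.

Lemma excess_supermodular X Y :
  (excess X + excess Y <= excess (X :|: Y) + excess (X :&: Y))%R.
Proof.
have := excess_setU_setI X Y.
have : #|span (X :&: Y)| <= #|span X :&: span Y|.
  by apply: subset_leq_card; rewrite subsetI !spanS ?subsetIl ?subsetIr.
lia.
Qed.

Lemma excess_setD1 X e : (excess X <= excess (X :\ e) + 1)%R.
Proof.
rewrite /excess /Delta.
have := subset_leq_card (spanS (subD1set X e)).
rewrite [edges (edge_subgraph G (X :\ e))]/= [edges (edge_subgraph G X)]/=.
have -> : (X :\ e) :&: edges G = (X :&: edges G) :\ e by rewrite setIDAC.
have := cardsD1 e (X :&: edges G); lia.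
Qed.

Lemma excessP : excess_function excess.
Proof.
by split; [exact: excess0|exact: excess_supermodular|exact: excess_setD1].
Qed.

(** Removing the edge at a leaf loses at least one vertex, and removing a cycle component loses as
    many vertices as edges; either deletion would leave a proper subset of no smaller excess. *)
Lemma critical_bowtie X : X \subset edges G -> critical excess X ->
  bowtie (edge_subgraph G X).
Proof.
move=> XG cX; set H := edge_subgraph G X.
have HE : edges H = X by apply/setIidPl.
have noI v : v \in vertices H -> star v H != set0.
  by move=> /(spanP v XG)[e eX ve]; apply/set0Pn; exists e; rewrite inE HE eX.
have lower Y : Y \proper X -> (#|Y| + #|span X| < #|X| + #|span Y|).
  move=> YX; have := cX _ YX; rewrite !excessE ?(subset_trans (proper_sub YX)) //.
  lia.
apply/and3P; split; apply/forall_inP => v vH.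
- by rewrite degree_eq0 noI.
- apply/negP => /eqP deg1; have /set0Pn[e es] := noI v vH.
  have eX : e \in X by move: es; rewrite inE HE => /andP[].
  have uniq f : f \in star v H -> f = e.
    have /card_le1_eqP eq1 : #|star v H| <= 1 by rewrite -deg1 star_degree.
    by move=> fs; apply: eq1.
  have sub : span (X :\ e) \subset span X :\ v.
    rewrite subsetD1 spanS ?subD1set //=; apply/negP => /bigcupP[f].
    rewrite !inE => /andP[/andP[fe fX] _] vf.
    by move: fe; rewrite (uniq f) ?eqxx // inE HE fX.
  have := lower _ (properD1 eX); have := subset_leq_card sub.
  by have := cardsD1 v (span X); rewrite vH; have := cardsD1 e X; rewrite eX; lia.
- apply/negP => /andP[_ /forall_inP all2].
  set W := vertices (component H v) in all2.
  pose D := edges (component H v).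
  have DX : D \subset X by rewrite -HE; apply/subsetP => e; rewrite inE => /andP[].
  have cDW : #|D| = #|W|.
    have := handshake (component H v).
    rewrite (eq_bigr (fun=> 2)) => [|u /all2/eqP //].
    by rewrite sum_nat_const -/D -/W; lia.
  have vW : v \in W by rewrite inE vH connect0.
  have W0 : 0 < #|W| by apply/card_gt0P; exists v.
  have WX : W \subset span X by apply/subsetP => u; rewrite inE => /andP[].
  have sub : span (X :\: D) \subset span X :\: W.
    rewrite subsetD spanS ?subsetDl //= disjoints_subset.
    apply/bigcupsP => e; rewrite in_setI in_setD => /andP[/andP[eD eX] _].
    apply/subsetP => u ue; rewrite inE; apply: contra eD => uW.
    have eH : e \in edges H by rewrite HE.
    by rewrite inE eH; apply: (component_ends eH ue uW).
  have /lower : X :\: D \proper X.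
    rewrite properEcard subsetDl cardsD (setIidPr DX) /=.
    by have := subset_leq_card DX; lia.
  have := subset_leq_card sub.
  rewrite !cardsD (setIidPr DX) (setIidPr WX).
  by have := subset_leq_card DX; have := subset_leq_card WX; lia.
Qed.

Lemma kcircuitP k C : 0 < k ->
  reflect [/\ C \subset edges G, critical excess C & excess C = k%:Z%R]
    (C \in kcircuits k G).
Proof.
move=> k0.
have crit (D : {set E}) : D \subset edges G -> critical excess D -> excess D = k%:Z%R ->
    D \in kcircuits k G.
  by move=> DG cD eD; rewrite inE DG critical_bowtie // andbT; apply/eqP.
apply: (iffP idP) => [Ck|[]]; last exact: crit.
have CG := kcircuit_sub Ck.
have eC : excess C = k%:Z%R by move: Ck; rewrite inE => /and3P[_ /eqP].
(* A proper subset of excess at least [k] would contain a critical set of excess [k], hence a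
   circuit properly inside [C]. *)
split=> // Y YC; rewrite ltNge; apply/negP => eY.
have [||Z ZY [cZ eZ]] := critical_sub excessP (n := k%:Z%R) (X := Y).
- lia.
- by rewrite -eC.
have ZC := subset_trans ZY (proper_sub YC).
have Zk : Z \in kcircuits k G by apply: crit; rewrite ?(subset_trans ZC).
have ZE := kcircuit_min k0 Zk Ck ZC.
by have := sub_proper_trans ZY YC; rewrite ZE properxx.
Qed.

(** Such an [X] is a circuit of the circular matroid whose parameter is its own excess, so
    [kcircuitP] applies at that parameter. *)
Lemma bowtie_critical X : X \subset edges G -> (0 < excess X)%R ->
  bowtie (edge_subgraph G X) -> critical excess X.
Proof.
move=> XG eX bX.
suff : X \in kcircuits (absz (excess X)) G by move/kcircuitP => [|//]; lia.
rewrite inE XG bX andbT; apply/eqP; change (excess X = `|excess X|%N%:Z)%R; lia.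
Qed.

End Excess.

(** * Common circuits of excess one and graph connectivity *)

Section Links.

Context {V E : finType} (G : graph V E).
Implicit Types (u v x : V) (e f g : E) (X Y Z C : {set E}).

Local Notation span X := (vertices (edge_subgraph G X)).
Local Notation critical := (critical (excess G)).

(** The excess drops by exactly one, which the lost edge already accounts for, so no vertex is
    lost. *)
Lemma critical_span_setD1 X e : X \subset edges G -> critical X -> e \in X ->
  span (X :\ e) = span X.
Proof.
move=> XG cX eX; apply/eqP; rewrite eqEcard spanS ?subD1set //=.
have := critical_setD1 (excessP G) cX eX.
rewrite !excessE ?(subset_trans (subD1set _ _)) //.
by have := cardsD1 e X; rewrite eX /=; lia.
Qed.

(** Lying on a common circuit of the bicircular matroid (the case [k = 1]) inside [X]. *)
Definition linked X e f : Prop :=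
  exists2 C : {set E}, C \subset X &
    [/\ critical C, excess G C = 1%R, e \in C & f \in C].

Section Fixed.
Variables (X : {set E}) (XG : X \subset edges G) (cX : critical X).

Lemma linked_trans g e f : linked X e g -> linked X g f -> linked X e f.
Proof.
case=> [C1 C1X [c1 d1 e1 g1]] [C2 C2X [c2 d2 g2 f2]].
have I12 : C1 :&: C2 != set0 by apply/set0Pn; exists g; rewrite inE g1.
have [C CU cC] := critical_trans (excessP G) c1 c2 d1 d2 I12 e1 f2.
by exists C => //; apply: subset_trans CU _; rewrite subUset C1X.
Qed.

Hypothesis posX : (0 < excess G X)%R.

Lemma linked_refl e : e \in X -> linked X e e.
Proof.
move=> eX; apply: (critical_common (excessP G) cX) => //; last by right.
Qed.

(* Two disjoint circuits [C1], [C2] of the bicircular matroid sharing a vertex: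
   removing an edge from each keeps all vertices, so the union of the rests
   still contains a circuit, which meets both [C1] and [C2]. *)
Lemma linked_touch e f v : e \in X -> f \in X -> v \in ends G e ->
  v \in ends G f -> linked X e f.
Proof.
move=> eX fX ve vf.
have [C1 C1X [c1 d1 e1 _]] := linked_refl eX.
have [C2 C2X [c2 d2 f2 _]] := linked_refl fX.
have C1G := subset_trans C1X XG; have C2G := subset_trans C2X XG.
have [I0|/set0Pn[g /setIP[g1 g2]]] := eqVneq (C1 :&: C2) set0; last first.
  by apply: (@linked_trans g); [exists C1 | exists C2].
have s1 := critical_span_setD1 C1G c1 e1.
have s2 := critical_span_setD1 C2G c2 f2.
have dU : (0 < excess G ((C1 :\ e) :|: (C2 :\ f)))%R.
  have := excess_setU_setI G (C1 :\ e) (C2 :\ f).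
  have -> : (C1 :\ e) :&: (C2 :\ f) = set0.
    by apply/eqP; rewrite -subset0 -I0 setISS ?subD1set.
  rewrite excess0 s1 s2.
  rewrite !(critical_setD1 (excessP G)) // d1 d2.
  have -> : #|span set0| = 0 by rewrite /= set0I big_set0 cards0.
  suff : 0 < #|span C1 :&: span C2| by clear; lia.
  apply/card_gt0P; exists v; rewrite inE.
  by apply/andP; split; [apply/(spanP _ C1G); exists e | apply/(spanP _ C2G); exists f].
have [||C3 C3U [c3 d3]] :=
  @critical_sub _ _ (excessP G) ((C1 :\ e) :|: (C2 :\ f)) 1%R.
- by [].
- by rewrite -gtz0_ge1.
have C3X : C3 \subset X.
  apply: subset_trans C3U _; rewrite subUset.
  by rewrite (subset_trans (subD1set _ _)) //= (subset_trans (subD1set _ _)).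
have out A B a b : C3 \subset (A :\ a) :|: (B :\ b) -> b \in B -> critical B ->
    excess G B = 1%R -> exists2 g, g \in C3 & g \in A.
  move=> CAB bB cB dB.
  have /subsetPn[g g3 gB] : ~~ (C3 \subset B :\ b).
    apply/negP => /sub_proper_trans/(_ (properD1 bB))/cB.
    by rewrite dB d3.
  exists g => //; have := subsetP CAB g g3.
  by rewrite in_setU (negbTE gB) orbF => /setD1P[].
have [g1 g13 g11] := out _ _ _ _ C3U f2 c2 d2.
rewrite setUC in C3U.
have [g2 g23 g22] := out _ _ _ _ C3U e1 c1 d1.
apply: (@linked_trans g1); first by exists C1.
by apply: (@linked_trans g2); [exists C3 | exists C2].
Qed.

Lemma connect_linked e f u v : e \in X -> f \in X -> u \in ends G e ->
  v \in ends G f -> connect (adj (edge_subgraph G X)) u v -> linked X e f.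
Proof.
move=> eX fX ue vf /connectP[p].
elim/last_ind: p f v fX vf => [|p z IH] f v fX vf.
  by move=> _ vu; rewrite /= in vu; apply: (linked_touch eX fX ue); rewrite -vu.
rewrite rcons_path last_rcons => /andP[pth az] vz; rewrite vz in vf.
case/existsP: az => g /and3P[/setIP[gX _] gl gz].
apply: (@linked_trans g); first exact: IH gX gl pth erefl.
exact: linked_touch gX fX gz vf.
Qed.

End Fixed.

(** If [v] were outside the component of [u], then [C] would split into two proper parts with
    disjoint spans, each of excess at most zero, whose excesses add up to one. *)
Lemma linked_connect X e f u v : X \subset edges G -> linked X e f ->
  u \in ends G e -> v \in ends G f ->
  connect (adj (edge_subgraph G X)) u v.
Proof.
move=> XG [C CX [cC dC eC fC]] ue vf.
set H := edge_subgraph G X; set W := component_vertices H u.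
have HE : edges H = X by apply/setIidPl.
have CG := subset_trans CX XG.
have uW : u \in W.
  by rewrite inE connect0 andbT; apply/spanP => //; exists e; rewrite ?(subsetP CX).
suff : v \in W by rewrite inE => /andP[].
apply: contraT => vW; pose C' := [set g in C | ends G g \subset W].
have closed g z : g \in C -> z \in ends G g -> z \in W -> g \in C'.
  move=> gC zg zW; rewrite inE gC; apply: (@component_ends _ _ H _ _ z) => //.
  by rewrite HE (subsetP CX).
have C'C : C' \subset C by apply/subsetP => g; rewrite inE => /andP[].
have p1 : C' \proper C.
  apply/properP; split=> //; exists f => //.
  by rewrite inE fC; apply: contra vW => /subsetP ->.
have p2 : C :\: C' \proper C.
  apply/properP; split; first exact: subsetDl.
  by exists e; rewrite // inE (closed e u).
have sep : span C' :&: span (C :\: C') = set0.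
  apply/setP => z; rewrite in_set0; apply/negbTE/negP => /setIP[].
  move=> /spanP -/(_ (subset_trans C'C CG))[g]; rewrite inE => /andP[gC /subsetP gW zg].
  move=> /spanP -/(_ (subset_trans (subsetDl _ _) CG))[h /setDP[hC /negP hC'] zh].
  by apply: hC'; apply: (closed h z) => //; apply: gW.
have := excess_setU_setI G C' (C :\: C').
have -> : C' :|: (C :\: C') = C.
  by rewrite -[RHS](setID C C') (setIidPr C'C).
rewrite sep cards0; have := cC _ p1; have := cC _ p2.
have -> : C' :&: (C :\: C') = set0 by rewrite setDE setICA setICr setI0.
by rewrite excess0 dC; clear; lia.
Qed.

End Links.

(** * Independence and rank in the [k]-circular matroid *)

Section KCircularRank.

Context {V E : finType} (k : nat) (k_gt0 : 0 < k) (G : graph V E).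
Implicit Types (u v x : V) (e f g : E) (X Y Z I B C : {set E}).

Local Notation span X := (vertices (edge_subgraph G X)).
Local Notation critical := (critical (excess G)).
Local Notation M := (kcircular k_gt0 G).

Lemma kindepP I : reflect
  (I \subset edges G /\ forall Y, Y \subset I -> (excess G Y < k%:Z)%R)
  (indep M I).
Proof.
rewrite /indep; apply: (iffP andP) => [[IG /forall_inP noC]|[IG small]].
  split=> // Y YI; rewrite ltNge; apply/negP => dY.
  have [|C CY [cC dC]] := critical_sub (excessP G) _ dY.
    lia.
  have CI := subset_trans CY YI.
  have /noC : C \in circuits M by apply/kcircuitP; rewrite ?(subset_trans CI).
  by rewrite CI.
split=> //; apply/forall_inP => C /kcircuitP[//|_ _ dC].
by apply/negP => /small; rewrite dC ltxx.
Qed.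

Lemma indep_card I Z : indep M I -> I \subset Z -> #|I| < #|span Z| + k.
Proof.
move=> /kindepP[IG /(_ I (subxx _))]; rewrite excessE // => dI IZ.
have := subset_leq_card (spanS G IZ); lia.
Qed.

Lemma critical_circuits Z : Z \subset edges G -> Z != set0 ->
    (forall e, e \in Z -> exists C, [/\ C \in kcircuits k G, e \in C & C \subset Z]) ->
  critical Z /\ (k%:Z <= excess G Z)%R.
Proof.
move=> ZG /set0Pn[e eZ] cov.
have cZ : critical Z.
  apply: (critical_cover (excessP G)) => f /cov[C [Ck fC CZ]].
  by exists C; split=> //; case/kcircuitP: Ck.
split=> //; have [C [/kcircuitP[//|_ _ <-] _ CZ]] := cov e eZ.
exact: critical_le.
Qed.

Lemma critical_circuit Z e f : Z \subset edges G -> critical Z ->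
    (k%:Z <= excess G Z)%R -> e \in Z -> f \in Z -> 1 < k \/ e = f ->
  exists C, [/\ C \in kcircuits k G, C \subset Z, e \in C & f \in C].
Proof.
move=> ZG cZ dZ eZ fZ kef.
have [||C CZ [cC dC eC fC]] := critical_common (excessP G) cZ _ dZ eZ fZ.
- lia.
- by case: kef => [k1|->]; [left; lia | right].
by exists C; split=> //; apply/kcircuitP; rewrite ?(subset_trans CZ).
Qed.

(* Each [e] in [Z :\: I] closes a circuit with [I], so its ends lie in the span
   of the largest subset [T] of [I] with excess [k - 1]; comparing the excess of
   [T :|: (Z :\: I)] and of [Z] bounds that of [I] from below. *)
Lemma maximal_indep_card Z I : Z \subset edges G -> critical Z ->
    (k%:Z <= excess G Z)%R ->
    maxset (fun J => indep M J && (J \subset Z)) I ->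
  #|I|.+1 = #|span Z| + k.
Proof.
move=> ZG cZ dZ /maxsetP[/andP[iI IZ] maxI].
have [IG smallI] := kindepP _ iI.
have fund e : e \in Z :\: I -> exists C, [/\ C \subset I,
    (k%:Z - 1 <= excess G C)%R & ends G e \subset span C].
  case/setDP => eZ eI; have eIZ : e |: I \subset Z by rewrite subUset sub1set eZ.
  have [||C CM CeI] := @dependent_circuit _ M (e |: I).
  - exact: subset_trans ZG.
  - apply: contra eI => ieI.
    by rewrite -(maxI (e |: I)) ?setU11 ?subsetUr // ieI.
  have [CG cC dC] := kcircuitP _ _ k_gt0 CM.
  have eC : e \in C.
    apply: contraLR iI => eC; apply: (circuit_dependent CM).
    by rewrite -(setU1K eI) subsetD1 CeI.
  exists (C :\ e); split; first by rewrite -(setU1K eI) setSD.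
    by rewrite (critical_setD1 (excessP G)) // dC.
  by rewrite critical_span_setD1 //; apply: span_ends.
(* [Z] itself is dependent, so an edge outside [I] exists and supplies a first tight set. *)
have [e0 e0D] : exists e, e \in Z :\: I.
  apply/set0Pn; rewrite setD_eq0; apply/negP => /smallI; lia.
pose tight C := (C \subset I) && (k%:Z - 1 <= excess G C)%R.
have [C0 [C0I dC0 _]] := fund e0 e0D.
have /maxset_exists[T /maxsetP[/andP[TI dT] maxT] _] : tight C0.
  by rewrite /tight C0I.
have endsT e : e \in Z :\: I -> ends G e \subset span T.
  case/fund => C [CI dC eC]; apply: subset_trans eC (spanS G _).
  (* The intersection of two tight sets has excess at most [k - 1], so their union is tight and the
     maximal [T] absorbs [C]. *)
  rewrite -(maxT (C :|: T)) ?subsetUl ?subsetUr // /tight subUset CI TI /=.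
  have := excess_supermodular G C T.
  have := smallI _ (subset_trans (subsetIl C T) CI); lia.
have spanD : span (Z :\: I) \subset span T.
  apply/bigcupsP => e /setIP[eD _]; exact: endsT.
have spanI : span I = span Z.
  have -> : Z = I :|: (Z :\: I) by rewrite -[LHS](setID Z I) (setIidPr IZ).
  rewrite spanU; apply/esym/setUidPl.
  exact: subset_trans spanD (spanS G TI).
have spanT : span (T :|: (Z :\: I)) = span T by rewrite spanU; apply/setUidPl.
have TG := subset_trans TI IG; have TZ := subset_trans TI IZ.
have UZ : T :|: (Z :\: I) \subset Z by rewrite subUset TZ subsetDl.
have cU : #|T :|: (Z :\: I)| = #|T| + #|Z :\: I|.
  suff TD0 : T :&: (Z :\: I) = set0 by rewrite cardsU TD0 cards0 subn0.
  apply/eqP; rewrite setI_eq0; apply: disjointWl TI _.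
  by rewrite -setI_eq0 setDE setICA setICr setI0.
have cZI : #|Z :\: I| + #|I| = #|Z|.
  by rewrite cardsD (setIidPr IZ) subnK ?subset_leq_card.
have := critical_le cZ UZ; have := smallI I (subxx _); move: dT.
by rewrite !excessE ?(subset_trans UZ) // spanT spanI cU; move: cZI; clear; lia.
Qed.

Section Full.

Hypotheses (noI : no_isolated G) (cG : critical (edges G)).
Hypothesis dG : (k%:Z <= excess G (edges G))%R.

Lemma basis_card B : basis M B -> #|B|.+1 = #|vertices G| + k.
Proof.
move=> bB; rewrite -(span_edges noI).
apply: maximal_indep_card => //; apply/maxsetP.
have iB := basis_indep bB; split; first by rewrite iB; case/andP: iB.
by move=> J /andP[iJ _] BJ; apply: (maxsetsup bB).
Qed.

Lemma indep_basis_card B : indep M B -> #|vertices G| + k <= #|B|.+1 ->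
  basis M B.
Proof.
move=> iB cB; have [B' bB' BB'] := indep_basis iB.
suff -> : B = B' by [].
by apply/eqP; rewrite eqEcard BB' -ltnS (basis_card bB').
Qed.

Lemma mrank_kcircular : (mrank M).+1 = #|vertices G| + k.
Proof.
have [|B bB _] := @indep_basis _ M set0.
  apply/kindepP; split=> [|Y]; first exact: sub0set.
  by rewrite subset0 => /eqP ->; rewrite excess0; lia.
rewrite -(basis_card bB); congr _.+1; apply/eqP; rewrite eqn_leq; apply/andP; split.
  apply/bigmax_leqP => I iI; rewrite -ltnS (basis_card bB) -(span_edges noI).
  by apply: indep_card => //; case/andP: iI.
exact: (@leq_bigmax_cond _ (indep M) (fun I : {set E} => #|I|) B (basis_indep bB)).
Qed.

End Full.

End KCircularRank.

(** * Vertex stars as cocircuits *)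

Section VertexStars.

Context {V E : finType} (k : nat) (k_gt0 : 0 < k) (G : graph V E).
Implicit Types (u v x : V) (e f g : E) (X Y Z I B C K : {set E}).

Local Notation span X := (vertices (edge_subgraph G X)).
Local Notation critical := (critical (excess G)).
Local Notation M := (kcircular k_gt0 G).

Lemma span_setD_star x : span (edges G :\: star x G) \subset vertices G :\ x.
Proof.
rewrite subsetD1 span_vertices /=.
apply/negP => /spanP -/(_ (subsetDl _ _))[e /setDP[eG]].
by rewrite inE eG => /negP.
Qed.

Lemma star_sub x : star x G \subset edges G.
Proof. by apply/subsetP => e; rewrite inE => /andP[]. Qed.

Lemma delete_vertex_bowtieE x : span (edges G :\: star x G) = vertices G :\ x ->
  bowtie (delete_vertex G x) = bowtie (edge_subgraph G (edges G :\: star x G)).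
Proof.
by move=> sp; apply: bowtie_ext => //=; apply/esym/setIidPl/subsetDl.
Qed.

Lemma delete_vertex_connectedE x :
  span (edges G :\: star x G) = vertices G :\ x ->
  graph_connected (delete_vertex G x) =
    graph_connected (edge_subgraph G (edges G :\: star x G)).
Proof.
by move=> sp; apply: graph_connected_ext => //=; apply/esym/setIidPl/subsetDl.
Qed.

Lemma no_isolated_span_setD_star x : no_isolated (delete_vertex G x) ->
  span (edges G :\: star x G) = vertices G :\ x.
Proof.
by move=> /span_edges /= <-; rewrite setIid (setIidPl (subsetDl _ _)).
Qed.

Lemma maximal_indep_exists Z : exists I,
  maxset (fun J => indep M J && (J \subset Z)) I.
Proof.
have [|I] := @maxset_exists _ (fun J => indep M J && (J \subset Z)) set0.
  rewrite sub0set andbT; apply/kindepP; split=> [|Y]; first exact: sub0set.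
  by rewrite subset0 => /eqP ->; rewrite excess0; lia.
by exists I.
Qed.

Lemma connected_deletion K (Z := edges G :\: K) : critical Z ->
  (k%:Z <= excess G Z)%R -> (k = 1 -> graph_connected (edge_subgraph G Z)) ->
  matroid_connected (deletion M K).
Proof.
move=> cZ dZ conn; have ZG : Z \subset edges G := subsetDl _ _.
have gZ : ground (deletion M K) = Z by [].
have circ C : C \in kcircuits k G -> C \subset Z -> C \in circuits (deletion M K).
  by move=> Ck CZ; apply/setIdP.
split; rewrite ?gZ.
- by apply: contraTneq dZ => ->; rewrite excess0; lia.
(* A single edge spans at least one vertex, so its excess is at most zero. *)
- move=> e eZ; apply/negP; rewrite /mloop => /setIdP[/kcircuitP[//|eG _]].
  rewrite excessE // cards1.
  have : span [set e] != set0 by apply: span_neq0 => //; apply/set0Pn; exists e; rewrite inE.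
  by rewrite -card_gt0; move: k_gt0; clear; lia.
- move=> e eZ; apply/coloopPn; rewrite ?gZ //.
  have [|C [Ck CZ eC _]] := critical_circuit k_gt0 ZG cZ dZ eZ eZ; first by right.
  by exists C => //; apply: circ.
move=> e f eZ fZ ef; have [k1|k1] := ltnP 1 k.
  have [|C [Ck CZ eC fC]] := critical_circuit k_gt0 ZG cZ dZ eZ fZ; first by left.
  by exists C; [exact: circ | rewrite eC].
have k1' : k = 1 by apply/eqP; rewrite eqn_leq k1.
have /andP[_ /forall_inP cGZ] := conn k1'.
have endpoint g : g \in Z -> exists2 u, u \in ends G g & u \in span Z.
  move=> gX; have /andP[_ /andP[/card_gt0P[u ug] _]] := endsP (subsetP ZG g gX).
  by exists u => //; apply/spanP => //; exists g.
have [u ue uZ] := endpoint e eZ; have [v vf vZ] := endpoint f fZ.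
have posZ : (0 < excess G Z)%R by apply: lt_le_trans dZ; rewrite k1'.
have [C CZ [cC dC eC fC]] := connect_linked ZG cZ posZ eZ fZ ue vf
  (forall_inP (cGZ u uZ) v vZ).
exists C; last by rewrite eC.
by apply: circ => //; apply/kcircuitP; rewrite ?k1' ?(subset_trans CZ).
Qed.

Hypotheses (noI : no_isolated G) (cG : critical (edges G)).
Hypothesis dG : (k%:Z <= excess G (edges G))%R.

(** A basis disjoint from the star would span at most [#|vertices G| - 1] vertices and so have too
    few edges. *)
Lemma star_not_coindep x : x \in vertices G -> ~~ coindep M (star x G).
Proof.
move=> xG; apply/coindepPn => [|B bB]; first exact: star_sub.
apply/negP => dB; have iB := basis_indep bB.
have BZ : B \subset edges G :\: star x G.
  by rewrite subsetD dB andbT; case/andP: iB.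
have := indep_card iB BZ; have := basis_card noI cG dG bB.
have := subset_leq_card (span_setD_star x).
have := cardsD1 x (vertices G); rewrite xG; clear; lia.
Qed.

(** The corank is [#|E| - #|V| - k + 1] and the remaining edges have excess
    [#|E| - #|star| - #|V| + 1], where [E] and [V] stand for the edges and vertices of [G]. *)
Lemma star_leq_corank x : x \in vertices G ->
  span (edges G :\: star x G) = vertices G :\ x ->
  (#|star x G| <= corank M) = (k%:Z <= excess G (edges G :\: star x G))%R.
Proof.
move=> xG sp; rewrite excessE ?subsetDl // sp /corank /=.
(* A nonempty star guards against truncation of the subtraction in [corank]. *)
have /set0Pn/card_gt0P s0 : star x G != set0.
  by rewrite -degree_eq0; apply: (forall_inP noI).
have := mrank_kcircular k_gt0 noI cG dG.
have := subset_leq_card (star_sub x).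
rewrite cardsD (setIidPr (star_sub x)).
have := cardsD1 x (vertices G); rewrite xG; move: s0; clear.
lia.
Qed.

Lemma star_cocircuit x : x \in vertices G ->
  span (edges G :\: star x G) = vertices G :\ x ->
  critical (edges G :\: star x G) ->
  (k%:Z <= excess G (edges G :\: star x G))%R ->
  cocircuit M (star x G).
Proof.
move=> xG sp cZ dZ; apply/minsetP; split.
  by rewrite star_sub star_not_coindep.
move=> K /andP[KG /(@coindepPn _ M K KG) hit] KS; apply/eqP; rewrite eqEsubset KS /=.
apply/subsetP => e eS; apply: contraT => eK.
set Z := edges G :\: star x G in sp cZ dZ *.
have [I maxI] := maximal_indep_exists Z.
have cI := maximal_indep_card (subsetDl _ _) cZ dZ maxI.
have /andP[iI IZ] := maxsetp maxI.
have [IG smallI] := kindepP _ _ _ iI.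
have [eG xe] : e \in edges G /\ x \in ends G e by apply/andP; rewrite inE in eS.
have eI : e \notin I by apply: contraTN eS => /(subsetP IZ)/setDP[].
(* The edge [e] brings the new vertex [x] with it, so adding it to a subset of [I] does not raise
   the excess. By cardinality [e |: I] is then a basis, and it misses [K]. *)
have ieI : indep M (e |: I).
  apply/kindepP; split=> [|Y YeI]; first by rewrite subUset sub1set eG.
  have YG : Y \subset edges G by apply: subset_trans YeI _; rewrite subUset sub1set eG.
  have YI : Y :\ e \subset I by rewrite subDset.
  apply: le_lt_trans (smallI _ YI).
  have [eY|eY] := boolP (e \in Y); last first.
    suff -> : Y :\ e = Y by [].
    by apply/setDidPl; rewrite disjoint_sym disjoints1.
  rewrite !excessE ?(subset_trans (subD1set _ _)) //.
  have xY : x \in span Y by apply/spanP => //; exists e.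
  have sub : span (Y :\ e) \subset span Y :\ x.
    rewrite subsetD1 spanS ?subD1set //=; apply/negP => xYe.
    have := subsetP (spanS G (subset_trans YI IZ)) x xYe.
    by rewrite sp !inE eqxx.
  have := subset_leq_card sub; have := cardsD1 x (span Y); rewrite xY.
  have := cardsD1 e Y; rewrite eY; clear; lia.
have beI : basis M (e |: I).
  apply: (indep_basis_card noI cG dG ieI); rewrite cardsU1 eI.
  by move: cI; rewrite sp (cardsD1 x (vertices G)) xG; clear; lia.
have := hit _ beI; rewrite -setI_eq0 => /negP[].
apply/eqP/setP => f; rewrite !inE; apply/negbTE/negP => /andP[/predU1P[->|/(subsetP IZ)]].
  by rewrite (negbTE eK).
by rewrite inE => /andP[/negP fS _] /(subsetP KS).
Qed.

Lemma nonseparating_star K : nonseparating_cocircuit M K -> K \subset edges G ->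
  exists2 x, x \in vertices G & [/\ K = star x G,
    span (edges G :\: star x G) = vertices G :\ x,
    critical (edges G :\: star x G),
    (k%:Z <= excess G (edges G :\: star x G))%R
  & k = 1 -> graph_connected (edge_subgraph G (edges G :\: star x G))].
Proof.
case=> /minsetP[/andP[_ ncK] minK] [nZ _ ncl pair] KG.
have hitK := @coindepPn _ M K KG ncK; pose Z := edges G :\: K.
have ZG : Z \subset edges G := subsetDl _ _.
have cov e : e \in Z -> exists C, [/\ C \in kcircuits k G, e \in C & C \subset Z].
  move=> eZ; have [+ _] := @coloopPn _ (deletion M K) e eZ.
  case/(_ (ncl e eZ)) => C /setIdP[Ck CZ] eC.
  by exists C.
have [cZ dZ] := critical_circuits k_gt0 ZG nZ cov.
have [I maxI] := maximal_indep_exists Z.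
have cI := maximal_indep_card ZG cZ dZ maxI.
have /andP[iI IZ] := maxsetp maxI.
(* If [Z] spanned every vertex, a maximal independent subset of [Z] would be a basis disjoint from
   [K]. *)
have ltZ : #|span Z| < #|vertices G|.
  rewrite ltnNge; apply/negP => leZ.
  have /hitK/negP[] : basis M I.
    by apply: (indep_basis_card noI cG dG iI); rewrite cI leq_add2r.
  by move: IZ; rewrite subsetD => /andP[].
have [x xG xZ] : exists2 x, x \in vertices G & x \notin span Z.
  by apply/subsetPn; apply: contraL ltZ => /subset_leq_card; rewrite -leqNgt.
have SK : star x G \subset K.
  apply/subsetP => e; rewrite inE => /andP[eG xe]; apply: contraR xZ => eK.
  by apply/spanP => //; exists e; rewrite // inE eK.
have KE : star x G = K by apply: minK; rewrite ?star_sub ?star_not_coindep.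
(* By minimality some basis [B] avoids [K :\ e]; then [B :\ e] lies in [Z] and has at least
   [#|vertices G| + k - 2] edges, too many if [Z] missed two vertices. *)
have gtZ : #|vertices G| <= #|span Z|.+1.
  have /set0Pn[e eS] : star x G != set0.
    by rewrite -degree_eq0; apply: (forall_inP noI).
  have eK : e \in K by rewrite -KE.
  have KeG : K :\ e \subset edges G := subset_trans (subD1set _ _) KG.
  have [B bB KB] : exists2 B : {set E}, basis M B & [disjoint B & K :\ e].
    have [/exists_inP[B bB]|nc] := boolP (coindep M (K :\ e)).
      by rewrite subsetD disjoint_sym => /andP[_ ?]; exists B.
    have /setP/(_ e) : K :\ e = K by apply: minK; rewrite ?KeG ?subD1set.
    by rewrite eK !inE eqxx.
  have iB := basis_indep bB.
  have BZ : B :\ e \subset Z.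
    rewrite subsetD (subset_trans (subD1set _ _)) /=; last by case/andP: iB.
    rewrite -setI_eq0 setIDAC -setIDA setI_eq0 //.
  have := indep_card (indepS (subD1set _ e) iB) BZ.
  have := basis_card noI cG dG bB; have := cardsD1 e B; clear.
  lia.
have sp : span Z = vertices G :\ x.
  apply/eqP; rewrite eqEcard subsetD1 span_vertices xZ /=.
  by move: gtZ; rewrite (cardsD1 x (vertices G)) xG.
exists x; rewrite // KE -/Z; split=> //; move=> k1.
apply/andP; split; first exact: span_neq0.
apply/forall_inP => u /(spanP _ ZG)[e eZ ue].
apply/forall_inP => v /(spanP _ ZG)[f fZ vf].
suff [C [Ck CZ eC fC]] : exists C, [/\ C \in kcircuits k G, C \subset Z,
    e \in C & f \in C].
  apply: (linked_connect ZG _ ue vf); exists C => //.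
  by case/kcircuitP: Ck => // CG cC dC; split; rewrite // dC k1.
have [<-|ef] := eqVneq e f; first by have [C []] := cov e eZ; exists C.
have [C /setIdP[Ck CZ] /andP[eC fC]] := pair e f eZ fZ ef.
by exists C.
Qed.

End VertexStars.

(** * Non-separating cocircuits and vertex stars *)

Theorem theorem4p12 (V E : finType) (k : nat) (k_gt0 : 0 < k)
    (G : graph V E) (K : {set E}) :
  no_isolated G ->
  matroid_connected (kcircular k_gt0 G) ->
  K \subset edges G ->
  nonseparating_cocircuit (kcircular k_gt0 G) K <->
  (exists x : V,
     [/\ x \in vertices G,
         K = star x G,
         #|star x G| <= corank (kcircular k_gt0 G),
         k = 1 -> connected_bowtie (delete_vertex G x)
       & 2 <= k -> bowtie (delete_vertex G x)]).
Proof.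
move=> noI [nE _ ncl _] KG.
(* Without coloops, circuits cover all edges, so [edges G] is critical. *)
have [cG dG] : critical (excess G) (edges G) /\ (k%:Z <= excess G (edges G))%R.
  apply: (critical_circuits k_gt0) => // e eG.
  have [+ _] := @coloopPn _ (kcircular k_gt0 G) e eG.
  case/(_ (ncl e eG)) => C CM eC; exists C; split=> //.
  exact: (circuit_sub CM).
split=> [nsK|[x [xG -> sx c1 c2]]].
  have [x xG [KE sp cZ dZ conn]] := nonseparating_star noI cG dG nsK KG.
  have bH : bowtie (delete_vertex G x).
    by rewrite delete_vertex_bowtieE // critical_bowtie ?subsetDl.
  exists x; split=> //; first by rewrite star_leq_corank.
  by move=> k1; rewrite /connected_bowtie bH delete_vertex_connectedE // conn.
have bH : bowtie (delete_vertex G x).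
  by have [/c2//|k1] := ltnP 1 k; have /c1/andP[] : k = 1 by lia.
have sp := no_isolated_span_setD_star (proj1 (andP bH)).
(* The bound on the star also makes this excess positive, as [bowtie_critical] requires. *)
have dZ : (k%:Z <= excess G (edges G :\: star x G))%R.
  by rewrite -(star_leq_corank k_gt0).
have cZ : critical (excess G) (edges G :\: star x G).
  apply: bowtie_critical; rewrite ?subsetDl -?delete_vertex_bowtieE //.
  by apply: lt_le_trans dZ; rewrite ltz_nat.
split; first exact: star_cocircuit.
apply: connected_deletion => // /c1/andP[].
by rewrite delete_vertex_connectedE.
Qed.
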